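(* For every integer $d\ge1$, $$S_d=[y^d]\mathscr H(1,y)=\sum_{1\le q_1<\cdots<q_d}b_{q_1}\cdots b_{q_d}.$$ Equivalently, $S_d$ is the $d$th elementary symmetric function of the positive summable sequence $(b_1,b_2,b_3,\ldots)$.
   Context: Let $$\mathscr H(u,y)=\prod_{q=1}^\infty\left[1+y\,\frac{q(e^{u/q}-1)-u}{u(q+1)}\right]$$ (removable singularity at $u=0$ filled in), which converges normally on compact subsets of $\mathbb C^2$. For $r\ge2$ and $1\le d\le r-1$ let $C_{r,d}=[u^{r-1}y^d]\mathscr H(u,y)$ be the coefficient of $u^{r-1}y^d$ in its Taylor expansion at $(0,0)$. For $d\ge1$ define the column mass $$S_d=\sum_{r\ge d+1}C_{r,d}.$$ For $q\ge1$ define $$b_q=\frac{e^{1/q}}{1+1/q}-1,$$ so that $\mathscr H(1,y)=\prod_{q\ge1}(1+yb_q)$. Here $[y^d]$ denotes extraction of the coefficient of $y^d$. *)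

(* Defs.v *)
From mathcomp Require Import all_boot all_order all_algebra.
From mathcomp Require Import complex.
From mathcomp Require Import all_classical all_reals all_analysis.

Set Implicit Arguments.
Unset Strict Implicit.
Unset Printing Implicit Defensive.

Import Order.TTheory GRing.Theory Num.Theory.
Import numFieldNormedType.Exports.

Local Open Scope classical_set_scope.
Local Open Scope ring_scope.

(* The complex numbers R[i], seen as a numFieldType so that the topology, the
   limits and the derivative [derive1n] of MathComp-Analysis apply: a derivative
   of a function [Cplx R -> Cplx R] is a complex derivative. *)
Definition Cplx (R : realType) : numFieldType := complex R.

Definition ofReal (R : realType) (x : R) : Cplx R := (x%:C)%C.

Definition expC (R : realType) (z : Cplx R) : Cplx R :=
  limn (series (fun n => z ^+ n / n`!%:R)).

(* The removable singularity at u = 0 has value 0, since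
   q (e^(u/q) - 1) - u = u^2 / (2 q) + O(u^3). *)
Definition factorH (R : realType) (q : nat) (u : Cplx R) : Cplx R :=
  if u == 0 then 0
  else (q%:R * (expC (u / q%:R) - 1) - u) / (u * (q%:R + 1)).

Definition prodH (R : realType) (u y : Cplx R) : Cplx R :=
  limn (fun N => \prod_(1 <= q < N) (1 + y * factorH q u)).

Definition taylor1 (R : realType) (f : Cplx R -> Cplx R) (d : nat) : Cplx R :=
  derive1n d f 0 / d`!%:R.

(* [u^m y^d] F = (d/du)^m (d/dy)^d F (0, 0) / (m! d!) *)
Definition taylor2 (R : realType) (F : Cplx R -> Cplx R -> Cplx R) (m d : nat) :
    Cplx R :=
  derive1n m (fun u => derive1n d (F u) 0) 0 / (m`!%:R * d`!%:R).

Definition taylorH (R : realType) (r d : nat) : Cplx R :=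
  taylor2 (@prodH R) r.-1 d.

Definition partial_mass (R : realType) (d N : nat) : Cplx R :=
  \sum_(d.+1 <= r < N) taylorH R r d.

Definition column_mass (R : realType) (d : nat) : Cplx R :=
  limn (partial_mass R d).

Definition bterm (R : realType) (q : nat) : R :=
  expR (1 / q%:R) / (1 + 1 / q%:R) - 1.

(* The d-th elementary symmetric function of (a_1, a_2, ...), for a >= 0: the
   unordered sum in [0, +oo] over the tuples 1 <= q_1 < ... < q_d. *)
Definition elem_sym (R : realType) (a : nat -> R) (d : nat) : \bar R :=
  \esum_(t in [set t : d.-tuple nat | sorted ltn t && all (leq 1) t])
    (\prod_(q <- t) a q)%:E.

(* Main.v *)
From HB Require Import structures.
Require Import Defs.
From mathcomp Require Import all_boot all_order all_algebra.
From mathcomp Require Import complex.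
From mathcomp Require Import all_classical all_reals all_analysis.
From mathcomp Require Import ring.
Import Order.TTheory GRing.Theory Num.Theory.
Import numFieldNormedType.Exports.
Local Open Scope classical_set_scope.
Local Open Scope ring_scope.

Set Implicit Arguments.
Unset Strict Implicit.
Unset Printing Implicit Defensive.

(** The two extractions of Taylor coefficients turn into one statement about
    series with nonnegative terms. Writing q for the shifted index, the factor
      g_q(u) = sum_(k >= 1) u^k / ((k+1)! (q+1)^k (q+2))
    is entire with nonnegative coefficients, bounded by those of w_q e^u where
    w_q = 1 / ((q+1)(q+2)) has sum at most 1. Let e_d^N be the d-th elementary
    symmetric polynomial of g_0, ..., g_(N-1). Its Taylor coefficients c_N(d,m)
    in u are nonnegative and nondecreasing in N, and the binomial theorem gives
      c_N(d,m) <= (sum_(q < N) w_q)^d / d! * d^m / m! <= d^m / (d! m!)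
    ([symcoef_le], [partial_esym_le_exp]), a bound free of N. So c_N(d,m) has a
    limit c(d,m), and dominated convergence ([psum_dominated]), used once in the
    variable u and once in y, yields
      H(u,y) = sum_d y^d E_d(u),   E_d(u) = sum_m c(d,m) u^m = lim_N e_d^N(u)
    for all complex u and y ([cvg_prod_factor], [cvg_partial_esym_factor]).

    Everything is read off from there. Entire power series may be differentiated
    term by term ([derive1_psum]), so C_(r,d) = c(d,r-1) and
    [y^d] H(1,y) = E_d(1). As g_q(0) = 0, c(d,m) vanishes for m < d, so the sum
    of c(d,r-1) over r >= d+1 is the whole series E_d(1). Finally g_q(1) is
    b_(q+1), hence E_d(1) = lim_N e_d(b_1, ..., b_N), which is the unordered sum
    over increasing d-tuples since the b_q are nonnegative.

    All the analysis rests on a single form of dominated convergence, with the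
    majorant M / 2^n ([tannery]): it gives the Cauchy product, termwise
    differentiation and the limits in N. For an entire series the radius can be
    doubled at will, so the ratio 1/2 is always available. *)

(** * Complex numbers over a real field, and absolutely convergent series *)

Section ComplexSeries.
Variable R : realType.
Local Notation K := (Cplx R).
Implicit Types (x : nat -> K) (M z : K).

HB.instance Definition _ :=
  GRing.RMorphism.copy (@ofReal R : R -> K) (real_complex R : R -> R[i]%C).

Lemma ofReal_le (a b : R) : (ofReal a <= ofReal b) = (a <= b).
Proof. by rewrite lecE /= eqxx. Qed.

Lemma ofReal_lt (a b : R) : (ofReal a < ofReal b) = (a < b).
Proof. by rewrite ltcE /= eqxx. Qed.

Lemma norm_ofReal (a : R) : `|ofReal a| = ofReal `|a|.
Proof. by rewrite normc_def /= expr0n /= addr0 sqrtr_sqr. Qed.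

Lemma real_ofReal z : z \is Num.real -> exists a : R, z = ofReal a.
Proof.
case: z => a b; rewrite realE !lecE /= => h; exists a.
by case/orP: h => /andP[/eqP hb _]; rewrite /ofReal -?hb // hb.
Qed.

Lemma norm_eq_ofReal z : exists2 r : R, 0 <= r & `|z| = ofReal r.
Proof.
have [r hr] := real_ofReal (normr_real z).
exists r => //; rewrite -ofReal_le -hr; exact: normr_ge0.
Qed.

Lemma cvg_ofReal (T : Type) (F : set_system T) (FF : Filter F) (f : T -> R) (l : R) :
  f @ F --> l -> (fun t => ofReal (f t)) @ F --> (ofReal l : K).
Proof.
move=> fl; apply/cvgrPdist_lt => e e0.
have [r er] := real_ofReal (gtr0_real e0).
have r0 : 0 < r by rewrite -ofReal_lt -er.
near=> t; rewrite -rmorphB norm_ofReal er ofReal_lt.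
by near: t; apply: cvgr_dist_lt.
Unshelve. all: by end_near.
Qed.

Lemma cvg_Re (T : Type) (F : set_system T) (FF : Filter F) (f : T -> R) (l : K) :
  (fun t => ofReal (f t)) @ F --> l -> f @ F --> complex.Re l.
Proof.
move=> fl; apply/cvgrPdist_lt => e e0.
have e0' : 0 < ofReal e by rewrite ofReal_lt.
near=> t.
have h : `|l - ofReal (f t)| < ofReal e by near: t; apply: cvgr_dist_lt.
rewrite -ofReal_lt; apply: le_lt_trans h.
by case: (l) => a b; exact: (normc_ge_Re ((Complex a b : K) - ofReal (f t))).
Unshelve. all: by end_near.
Qed.

(** Majorant of all the series below. The bound lives in the complex field,
    where M is then automatically real and nonnegative. *)
Definition geometric_bound M x := forall n, `|x n| <= M / 2 ^+ n.

Lemma geometric_bound_ge0 M x : geometric_bound M x -> 0 <= M.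
Proof. by move=> /(_ 0%N); rewrite expr0 divr1; apply: le_trans. Qed.

(** The real and imaginary parts are dominated by the same geometric series, so
    completeness of the reals suffices. *)
Lemma cvg_geometric_bound M x : geometric_bound M x -> cvgn (series x).
Proof.
move=> gx; have M0 := geometric_bound_ge0 gx.
have [m Mm] := real_ofReal (ger0_real M0).
have cvr (y : nat -> R) : (forall n, ofReal `|y n| <= `|x n|) -> cvgn (series y).
  move=> yx; apply: normed_cvg.
  apply: (@series_le_cvg _ _ (geometric m (2^-1))) => //=.
  - by move=> n; rewrite mulr_ge0 ?exprn_ge0 ?invr_ge0 //
       -ofReal_le -Mm.
  - move=> n; rewrite -ofReal_le; apply: (le_trans (yx n)); apply: (le_trans (gx n)).
    by rewrite Mm rmorphM rmorphXn fmorphV rmorph_nat exprVn.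
  - by apply: is_cvg_geometric_series; rewrite gtr0_norm ?invf_lt1 ?ltr1n ?invr_gt0.
have cre : cvgn (series (fun n => complex.Re (x n))).
  by apply: cvr => n; apply: normc_ge_Re.
have cim : cvgn (series (fun n => complex.Im (x n))).
  apply: cvr => n; rewrite normc_def lecE /= eqxx /=.
  by rewrite -sqrtr_sqr ler_wsqrtr // lerDr sqr_ge0.
apply/cvg_ex; eexists.
have -> : series x = (fun N => ofReal (series (fun n => complex.Re (x n)) N)
     + (Complex 0 1 : K) * ofReal (series (fun n => complex.Im (x n)) N)).
  apply/funext => N; rewrite /series /= !rmorph_sum mulr_sumr -big_split /=.
  apply: eq_bigr => n _; case: (x n) => a b /=.
  by apply/eqP; rewrite eq_complex /= !(mul0r, mul1r, subr0, addr0, add0r) !eqxx.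
apply: cvgD; first exact: cvg_ofReal cre.
apply: cvgMl_tmp; exact: cvg_ofReal cim.
Qed.

End ComplexSeries.

(** * Dominated convergence of series *)

Section Tannery.
Variable R : realType.
Local Notation K := (Cplx R).
Implicit Types (x : nat -> K) (M z : K).

Definition tsum x : K := limn (series x).

Lemma tsum_cvg_eq x l : series x @ \oo --> l -> tsum x = l.
Proof. by move=> xl; apply: cvg_lim => //; apply: norm_hausdorff. Qed.

(** The order of the complex numbers is partial, but norms and bounds are real,
    hence comparable. *)
Lemma le_norm_cvg (T : Type) (F : set_system T) (FF : ProperFilter F)
    (f : T -> K) (l B : K) :
  f @ F --> l -> B \is Num.real -> (\forall t \near F, `|f t| <= B) -> `|l| <= B.
Proof.
move=> fl Br fB; rewrite real_leNgt ?normr_real //; apply/negP => Bl.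
have h : \forall t \near F, B < `|f t| by apply: cvgr_norm_gt Bl.
have [t [h1 h2]] := filter_ex (filterI h fB).
by have := lt_le_trans h1 h2; rewrite ltxx.
Qed.

Lemma geometric_small M (e : K) : 0 <= M -> 0 < e -> exists k, M / 2 ^+ k < e.
Proof.
move=> M0 e0.
have [m Mm] := real_ofReal (ger0_real M0).
have [r er] := real_ofReal (gtr0_real e0).
have r0 : 0 < r by rewrite -ofReal_lt -er.
have m0 : 0 <= m by rewrite -ofReal_le -Mm.
exists (Num.bound (m / r)).
rewrite Mm er -(rmorph_nat (@ofReal R : R -> K)) -rmorphXn -fmorphV -rmorphM ofReal_lt.
rewrite ltr_pdivrMr ?exprn_gt0 // mulrC -ltr_pdivrMr //.
apply: (lt_trans (archi_boundP _)); first by rewrite divr_ge0 // ltW.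
by rewrite -natrX ltr_nat ltn_expl.
Qed.

Lemma tsum_tail M x k :
  geometric_bound M x -> `|tsum x - series x k| <= 2 * M / 2 ^+ k.
Proof.
move=> gx; have M0 := geometric_bound_ge0 gx.
have cx : (fun n => series x n - series x k) @ \oo --> tsum x - series x k.
  by apply: cvgB; [exact: cvg_geometric_bound gx | exact: cvg_cst].
apply: (le_norm_cvg _ cx).
  by apply: ger0_real; rewrite divr_ge0 ?mulr_ge0 ?exprn_ge0.
exists k => // n /= /subnKC <-.
have tel j : `|series x (k + j)%N - series x k|
    <= 2 * M / 2 ^+ k - 2 * M / 2 ^+ (k + j).
  elim: j => [|j IH]; first by rewrite addn0 !subrr normr0.
  rewrite addnS [series x _.+1]seriesSr addrAC.
  apply: (le_trans (ler_normD _ _)).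
  apply: (le_trans (lerD IH (gx _))).
  rewrite le_eqVlt; apply/orP; left; apply/eqP.
  (* the claimed bound decreases by exactly the term M / 2^(k+j) *)
  have : 2 ^+ (k + j) != 0 :> K by rewrite expf_neq0 ?pnatr_eq0.
  by rewrite exprS; move: (2 ^+ (k + j)) (2 ^+ k)^-1 => p q p0; field.
by apply: (le_trans (tel _)); rewrite gerBl divr_ge0 ?mulr_ge0 ?exprn_ge0.
Qed.

Lemma norm_tsum_le M x : geometric_bound M x -> `|tsum x| <= 2 * M.
Proof.
move=> /(tsum_tail 0); rewrite /series /= big_geq // subr0.
by rewrite expr0 divr1.
Qed.

Lemma cvg_partial_sum (T : Type) (F : set_system T) (FF : Filter F)
    (x : T -> nat -> K) (l : nat -> K) k :
  (forall n, (fun t => x t n) @ F --> l n) ->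
  (fun t => series (x t) k) @ F --> series l k.
Proof.
move=> xl; elim: k => [|k IH].
  have s0 (y : nat -> K) : series y 0 = 0 by rewrite /series /= big_geq.
  by rewrite s0; under eq_fun do rewrite s0; exact: cvg_cst.
rewrite seriesSr; under eq_fun do rewrite seriesSr.
exact: (cvgD IH (xl k)).
Qed.

(** Tannery's theorem along an arbitrary filter: it serves both for N to
    infinity and for difference quotients. Cutting at a rank k where the tails
    are uniformly below e/3 leaves a finite sum, which converges termwise. *)
Lemma tannery (T : Type) (F : set_system T) (FF : ProperFilter F)
    (x : T -> nat -> K) (l : nat -> K) M :
  (\forall t \near F, geometric_bound M (x t)) ->
  (forall n, (fun t => x t n) @ F --> l n) ->
  (fun t => tsum (x t)) @ F --> tsum l.
Proof.
move=> gx xl.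
have M0 : 0 <= M by have [t gt] := filter_ex gx; exact: geometric_bound_ge0 gt.
have gl : geometric_bound M l.
  move=> n; apply: (le_norm_cvg _ (xl n)).
    by apply: ger0_real; rewrite divr_ge0 ?exprn_ge0.
  near=> t; have gt : geometric_bound M (x t) by near: t.
  exact: gt.
apply/cvgrPdist_lt => e e0.
have e3 : 0 < e / 3 by rewrite divr_gt0.
have [|k hk] := geometric_small (M := 2 * M) _ e3; first by rewrite mulr_ge0.
have cs : (fun t => series (x t) k) @ F --> series l k.
  exact: cvg_partial_sum.
near=> t.
have h1 : `|series l k - series (x t) k| < e / 3.
  by near: t; apply: cvgr_dist_lt.
have h2 : geometric_bound M (x t) by near: t.
have -> : tsum l - tsum (x t) = (tsum l - series l k)
   + (series l k - series (x t) k) - (tsum (x t) - series (x t) k) by ring.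
have -> : e = e / 3 + e / 3 + e / 3 by field.
apply: (le_lt_trans (ler_normB _ _)); apply: ler_ltD.
  apply: (le_trans (ler_normD _ _)); apply: lerD.
    by apply: le_trans (tsum_tail k gl) _; apply: ltW.
  exact: ltW.
by apply: le_lt_trans (tsum_tail k h2) _.
Unshelve. all: by end_near.
Qed.

End Tannery.

(** * Entire power series *)

Section PowerSeries.
Variable R : realType.
Local Notation K := (Cplx R).
Implicit Types (x a b : nat -> K) (M z : K).

(** The series of [a] has infinite radius of convergence; bounded terms at every
    radius is the form of this that passes most easily to other sequences. *)
Definition entire a := forall r : K, 0 <= r ->
  exists M, forall n, `|a n| * r ^+ n <= M.

Definition psum a z : K := tsum (fun n => a n * z ^+ n).

(** Bounded terms at radius 2 r are geometric terms of ratio 1/2 at radius r. *)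
Lemma entire_geometric a r : entire a -> 0 <= r ->
  exists M, forall b z, (forall n, `|b n| <= `|a n|) -> `|z| <= r ->
    geometric_bound M (fun n => b n * z ^+ n).
Proof.
move=> ea r0; have [|M hM] := ea (2 * r); first by rewrite mulr_ge0.
exists M => b z ba zr n.
rewrite ler_pdivlMr ?exprn_gt0 // normrM normrX -mulrA.
apply: le_trans (hM n); apply: ler_pM => //.
rewrite mulrC -exprMn; apply: lerXn2r; last exact: ler_wpM2l.
  by rewrite nnegrE mulr_ge0.
by rewrite nnegrE mulr_ge0.
Qed.

Lemma entire_le a b : entire a -> (forall n, `|b n| <= `|a n|) -> entire b.
Proof.
move=> ea ba r r0; have [M hM] := ea r r0; exists M => n.
by apply: le_trans (hM n); rewrite ler_wpM2r ?exprn_ge0.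
Qed.

Lemma cvg_psum a z : entire a -> series (fun n => a n * z ^+ n) @ \oo --> psum a z.
Proof.
move=> ea; have [M hM] := entire_geometric ea (normr_ge0 z).
exact: (cvg_geometric_bound (hM a z (fun n => lexx _) (lexx _))).
Qed.

Lemma psum_dominated (T : Type) (F : set_system T) (FF : ProperFilter F)
    (b : T -> nat -> K) a l z :
  entire a -> (\forall t \near F, forall n, `|b t n| <= `|a n|) ->
  (forall n, (fun t => b t n) @ F --> l n) ->
  (fun t => psum (b t) z) @ F --> psum l z.
Proof.
move=> ea ba bl; have [M hM] := entire_geometric ea (normr_ge0 z).
apply: (@tannery _ _ _ _ _ _ M).
  near=> t; apply: hM => // n.
  have h : forall n, `|b t n| <= `|a n| by near: t.
  exact: h.
by move=> n; apply: cvgMr_tmp; apply: bl.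
Unshelve. all: by end_near.
Qed.

Lemma psumD a b z : entire a -> entire b ->
  psum (fun n => a n + b n) z = psum a z + psum b z.
Proof.
move=> ea eb; apply: tsum_cvg_eq.
have -> : series (fun n => (a n + b n) * z ^+ n) =
    (fun N => series (fun n => a n * z ^+ n) N + series (fun n => b n * z ^+ n) N).
  apply/funext => N; rewrite /series /= -big_split.
  by apply: eq_bigr => n _; rewrite mulrDl.
exact: (cvgD (cvg_psum ea) (cvg_psum eb)).
Qed.

Lemma entireZ c a : entire a -> entire (fun n => c * a n).
Proof.
move=> ea r r0; have [M hM] := ea r r0; exists (`|c| * M) => n.
by rewrite normrM -mulrA ler_wpM2l.
Qed.

Lemma psumZ c a z : entire a -> psum (fun n => c * a n) z = c * psum a z.
Proof.
move=> ea; apply: tsum_cvg_eq.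
have -> : series (fun n => c * a n * z ^+ n) =
    (fun N => c * series (fun n => a n * z ^+ n) N).
  apply/funext => N; rewrite /series /= mulr_sumr.
  by apply: eq_bigr => n _; rewrite mulrA.
exact: (cvgMl_tmp (cvg_psum ea)).
Qed.

Lemma psum_poly (p : {poly K}) z : psum (fun n => p`_n) z = p.[z].
Proof.
apply: tsum_cvg_eq; apply: cvg_near_cst; exists (size p) => // n /= hn.
rewrite horner_coef /series /= big_mkord.
rewrite (big_ord_widen n (fun i => p`_i * z ^+ i) hn) [RHS]big_mkcond /=.
by apply: eq_bigr => i _; case: ltnP => // /(nth_default 0) ->; rewrite mul0r.
Qed.

Lemma psum_series a z k :
  psum (fun n => if (n < k)%N then a n else 0) z = series (fun n => a n * z ^+ n) k.
Proof.
apply: tsum_cvg_eq; apply: cvg_near_cst; exists k => // n /= hn.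
rewrite /series /= (big_cat_nat (leq0n k) hn) /= [X in _ + X]big1_seq ?addr0.
  by rewrite !big_nat; apply: eq_bigr => i /= ->.
move=> i; rewrite mem_index_iota => /andP[_ /andP[ki _]].
by rewrite ltnNge ki mul0r.
Qed.

Definition cauchy_prod (L : pzSemiRingType) (a b : nat -> L) n : L :=
  \sum_(k < n.+1) a k * b (n - k)%N.

(** At radius r the n-th term has n + 1 summands, each at most M N / 2^n once the
    bounds are taken at radius 2 r, and n + 1 <= 2^n. *)
Lemma entire_cauchy_prod a b : entire a -> entire b ->
  entire (cauchy_prod (fun n => `|a n|) (fun n => `|b n|)).
Proof.
move=> ea eb r r0.
have r20 : 0 <= 2 * r by rewrite mulr_ge0.
have [M hM] := ea _ r20; have [N hN] := eb _ r20.
have M0 : 0 <= M by apply: le_trans (hM 0%N); rewrite expr0 mulr1.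
exists (M * N) => n.
have t0 : 0 < 2 ^+ n :> K by rewrite exprn_gt0.
rewrite -(ler_pM2r t0) ger0_norm; last by apply: sumr_ge0 => i _; rewrite mulr_ge0.
rewrite -mulrA -exprMn mulrC [r * 2]mulrC /cauchy_prod mulr_sumr.
apply: (@le_trans _ _ (\sum_(k < n.+1) M * N)).
  apply: ler_sum => k _; have kn : (k <= n)%N by rewrite -ltnS.
  rewrite -{1}(subnKC kn) exprD mulrACA ![_ ^+ _ * _]mulrC.
  by apply: ler_pM => //; rewrite mulr_ge0 ?exprn_ge0.
rewrite sumr_const card_ord -[leLHS]mulr_natr ler_wpM2l //.
  by rewrite mulr_ge0 //; apply: le_trans (hN 0%N); rewrite expr0 mulr1.
by rewrite -natrX ler_nat ltn_expl.
Qed.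

(** For truncated series this is the product of polynomials. Truncations at rank k
    leave the n-th coefficient of the product unchanged as soon as k > n, and are
    dominated by the Cauchy product of the norms. *)
Lemma psum_cauchy_prod a b z : entire a -> entire b ->
  entire (cauchy_prod a b) /\ psum (cauchy_prod a b) z = psum a z * psum b z.
Proof.
move=> ea eb; have eab := entire_cauchy_prod ea eb.
have dom (a' b' : nat -> K) n : (forall k, `|a' k| <= `|a k|) ->
    (forall k, `|b' k| <= `|b k|) ->
    `|cauchy_prod a' b' n| <= `|cauchy_prod (fun n => `|a n|) (fun n => `|b n|) n|.
  move=> ha hb; rewrite [leRHS]ger0_norm; last first.
    by apply: sumr_ge0 => i _; rewrite mulr_ge0.
  apply: (le_trans (ler_norm_sum _ _ _)); apply: ler_sum => k _.
  by rewrite normrM; apply: ler_pM.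
split; first by apply: entire_le eab _ => n; apply: dom.
pose tr k (c : nat -> K) n := if (n < k)%N then c n else 0.
have trle k (c : nat -> K) n : `|tr k c n| <= `|c n|.
  by rewrite /tr; case: ifP => //; rewrite normr0.
have lim1 : (fun k => psum (cauchy_prod (tr k a) (tr k b)) z) @ \oo -->
    psum (cauchy_prod a b) z.
  apply: (psum_dominated _ eab); first by near=> k => n; apply: dom => j; apply: trle.
  move=> n; apply: cvg_near_cst; exists n.+1 => // k /= nk.
  apply: eq_bigr => i _.
  have ik : (i < k)%N := leq_trans (ltn_ord i) nk.
  have ik' : (n - i < k)%N := leq_ltn_trans (leq_subr _ _) nk.
  by rewrite /tr ik ik'.
have lim2 : (fun k => psum (cauchy_prod (tr k a) (tr k b)) z) @ \oo -->
    psum a z * psum b z.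
  have -> : (fun k => psum (cauchy_prod (tr k a) (tr k b)) z) =
     (fun k => series (fun n => a n * z ^+ n) k * series (fun n => b n * z ^+ n) k).
    apply/funext => j; rewrite -!psum_series.
    have trp (c : nat -> K) : (fun n => if (n < j)%N then c n else 0)
        = (fun n => (\poly_(i < j) c i)`_n) by apply/funext => m; rewrite coef_poly.
    rewrite /tr !trp !psum_poly -hornerM -psum_poly.
    by congr psum; apply/funext => m; rewrite coefM.
  exact: (cvgM (cvg_psum ea) (cvg_psum eb)).
exact: (norm_cvg_unique lim1 lim2).
Unshelve. all: by end_near.
Qed.

End PowerSeries.

(** * Termwise differentiation *)

Section PowerSeriesDerivative.
Variable R : realType.
Local Notation K := (Cplx R).
Implicit Types (a : nat -> K) (z : K).

Definition dcoef a n : K := n.+1%:R * a n.+1.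

(** The factor n + 1 is absorbed by doubling the radius; the shift of index, by
    taking the radius at least 1. *)
Lemma entire_dcoef a : entire a -> entire (dcoef a).
Proof.
move=> ea r r0.
have s0 : 0 <= 2 * (r + 1) by rewrite mulr_ge0 ?addr_ge0.
have [M hM] := ea _ s0; exists M => n.
apply: le_trans (hM n.+1).
rewrite /dcoef normrM normr_nat -mulrA mulrCA ler_wpM2l //.
rewrite exprMn; apply: ler_pM; rewrite ?exprn_ge0 //.
  by rewrite -natrX ler_nat; apply/ltnW/ltn_expl.
rewrite exprS -[leLHS]mul1r; apply: ler_pM; rewrite ?exprn_ge0 //.
  by rewrite lerDr.
by apply: lerXn2r; rewrite ?nnegrE ?addr_ge0 ?lerDl.
Qed.

Lemma psum_at0 a : psum a 0 = a 0%N.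
Proof.
apply: tsum_cvg_eq; apply: cvg_near_cst; exists 1%N => // -[//|n] _.
rewrite /series /= big_nat_recl //= expr0 mulr1 big1 ?addr0 // => i _.
by rewrite exprS mul0r mulr0.
Qed.

Lemma cvg_exprn (n : nat) z : (fun h : K => (h + z) ^+ n) @ 0^' --> z ^+ n.
Proof.
elim: n => [|n IH]; first by under eq_fun do rewrite expr0; exact: cvg_cst.
rewrite exprS; under eq_fun do rewrite exprS.
have c1 : (fun h : K => h + z) @ 0^' --> z.
  rewrite -[X in _ --> X]add0r; apply: cvgD; last exact: cvg_cst.
  exact: (cvg_within).
exact: (cvgM c1 IH).
Qed.

(** The quotient ((h + z)^n - z^n) / h in factored form, meaningful at h = 0. *)
Let diff_quot (h z : K) n : K := \sum_(i < n) (h + z) ^+ (n.-1 - i) * z ^+ i.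

Lemma cvg_diff_quot z n : (fun h => diff_quot h z n) @ 0^' --> n%:R * z ^+ n.-1.
Proof.
have -> : n%:R * z ^+ n.-1 = series (fun i => z ^+ (n.-1 - i) * z ^+ i) n.
  rewrite /series /= big_mkord.
  transitivity (\sum_(i < n) z ^+ n.-1).
    by rewrite sumr_const card_ord mulr_natl.
  apply: eq_bigr => i _; rewrite -exprD subnK //.
  by have := ltn_ord i; case: n i.
have -> : (fun h => diff_quot h z n)
    = (fun h => series (fun i => (h + z) ^+ (n.-1 - i) * z ^+ i) n).
  by apply/funext => h; rewrite /series /= big_mkord.
apply: cvg_partial_sum => i; apply: cvgMr_tmp; exact: cvg_exprn.
Qed.

Lemma natr_exp_le4 (F : numFieldType) (B : F) n :
  0 <= B -> n%:R * B ^+ n * 2 ^+ n <= (4 * B) ^+ n.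
Proof.
move=> B0; have -> : 4 * B = 2 * (2 * B) by ring.
rewrite exprMn [(2 * B) ^+ n]exprMn mulrC ler_wpM2l ?exprn_ge0 //.
rewrite ler_wpM2r ?exprn_ge0 //.
by rewrite -natrX ler_nat; apply/ltnW/ltn_expl.
Qed.

(** For |h| <= 1 the n-th difference quotient is at most n (|z| + 1)^n, so radius
    4 (|z| + 1) provides a majorant of ratio 1/2 independent of h. *)
Lemma derive1_psum a z : entire a -> derive1 (psum a) z = psum (dcoef a) z.
Proof.
move=> ea; rewrite /derive1; apply: cvg_lim; first exact: norm_hausdorff.
have s0 : 0 <= 4 * (`|z| + 1) by rewrite mulr_ge0 ?addr_ge0.
have [M hM] := ea _ s0.
have -> : psum (dcoef a) z = tsum (fun n => a n * (n%:R * z ^+ n.-1)).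
  apply/esym/tsum_cvg_eq; rewrite -cvg_shiftS.
  have -> : (fun N => series (fun n => a n * (n%:R * z ^+ n.-1)) N.+1)
      = series (fun n => dcoef a n * z ^+ n).
    apply/funext => N; rewrite /series /= big_nat_recl //= mul0r mulr0 add0r.
    by apply: eq_bigr => i _; rewrite /dcoef mulrCA mulrA.
  exact: cvg_psum (entire_dcoef ea).
have key : (fun h => tsum (fun n => a n * diff_quot h z n)) @ 0^' -->
    tsum (fun n => a n * (n%:R * z ^+ n.-1)).
  apply: (@tannery _ _ _ _ _ _ M); last first.
    by move=> n; apply: cvgMl_tmp; apply: cvg_diff_quot.
  have h1 : \forall h \near (0 : K)^', `|h| <= 1.
    exact: dnbhs0_le.
  near=> h.
  have hh : `|h| <= 1 by near: h.
  move=> n; rewrite ler_pdivlMr ?exprn_gt0 //; apply: le_trans (hM n).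
  rewrite normrM -mulrA ler_wpM2l //.
  have hn : `|diff_quot h z n| <= n%:R * (`|z| + 1) ^+ n.
    have z1 : 1 <= `|z| + 1 by rewrite lerDr.
    have z0 : 0 <= `|z| + 1 by rewrite addr_ge0.
    have hz : `|h + z| <= `|z| + 1.
      by apply: (le_trans (ler_normD _ _)); rewrite addrC lerD2l.
    apply: (le_trans (ler_norm_sum _ _ _)).
    rewrite mulr_natl -[in leRHS](card_ord n) -sumr_const; apply: ler_sum => i _.
    rewrite card_ord normrM !normrX.
    apply: (@le_trans _ _ ((`|z| + 1) ^+ (n.-1 - i) * (`|z| + 1) ^+ i)).
      apply: ler_pM; rewrite ?exprn_ge0 //; apply: lerXn2r => //.
      by rewrite lerDl.
    by rewrite -exprD ler_weXn2l // subnK; case: n i => [[]|n i] //=; rewrite -ltnS.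
  apply: (le_trans (ler_wpM2r _ hn)); first by rewrite exprn_ge0.
  exact: natr_exp_le4.
apply: cvg_trans key; apply: near_eq_cvg; near=> h.
have h0 : h != 0 by near: h; exact: nbhs_dnbhs_neq.
apply: tsum_cvg_eq.
have -> : series (fun n => a n * diff_quot h z n) = (fun N => h^-1 *
   (series (fun n => a n * (h + z) ^+ n) N - series (fun n => a n * z ^+ n) N)).
  apply/funext => N; rewrite /series /= -sumrB mulr_sumr; apply: eq_bigr => n _.
  by rewrite -mulrBr subrXX addrK mulrCA mulKf.
by apply: cvgMl_tmp; apply: cvgB; apply: cvg_psum.
Unshelve. all: by end_near.
Qed.

Lemma derive1n_psum0 a n : entire a -> derive1n n (psum a) 0 = n`!%:R * a n.
Proof.
elim: n a => [|n IH] a ea; first by rewrite derive1n0 psum_at0 fact0 mul1r.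
have -> : derive1n n.+1 (psum a) = derive1n n (psum (dcoef a)).
  by rewrite derive1Sn; congr derive1n; apply/funext => z; apply: derive1_psum.
by rewrite IH ?factS ?natrM; [rewrite /dcoef; ring|exact: entire_dcoef].
Qed.

End PowerSeriesDerivative.

(** * Elementary symmetric polynomials and their coefficients *)

Section ElementarySymmetric.

(** The d-th elementary symmetric polynomial of [g 0], ..., [g (N - 1)]. *)
Fixpoint partial_esym (L : pzSemiRingType) (g : nat -> L) (N d : nat) : L :=
  match N, d with
  | 0, _ => (d == 0%N)%:R
  | N'.+1, 0 => 1
  | N'.+1, d'.+1 => partial_esym g N' d + g N' * partial_esym g N' d'
  end.

Lemma partial_esym0r (L : pzSemiRingType) (g : nat -> L) N : partial_esym g N 0 = 1.
Proof. by case: N. Qed.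

Lemma coef_prod_partial_esym (L : comNzRingType) (g : nat -> L) N d :
  (\prod_(0 <= q < N) (1 + g q *: 'X))`_d = partial_esym g N d.
Proof.
elim: N d => [|N IH] d; first by rewrite big_geq // coef1.
rewrite big_nat_recr //= mulrDr mulr1 coefD -scalerAr coefZ coefMX !IH.
by case: d => [|d]; rewrite ?partial_esym0r ?mulr0 ?addr0.
Qed.

Lemma partial_esym_morph (L1 L2 : pzSemiRingType) (f : {rmorphism L1 -> L2})
    (g : nat -> L1) N d :
  f (partial_esym g N d) = partial_esym (fun q => f (g q)) N d.
Proof.
elim: N d => [|N IH] [|d] /=; rewrite ?rmorph1 ?rmorph0 //.
by rewrite rmorphD rmorphM !IH.
Qed.

Lemma partial_esym_ge0 (F : numDomainType) (w : nat -> F) N d :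
  (forall q, 0 <= w q) -> 0 <= partial_esym w N d.
Proof.
move=> w0; elim: N d => [|N IH] [|d] //=.
by rewrite addr_ge0 ?mulr_ge0.
Qed.

(** Expanding (w_0 + ... + w_(N-1))^d gives each squarefree monomial d! times.
    In the induction the new weight only needs the first two binomial terms. *)
Lemma partial_esym_le_exp (F : numFieldType) (w : nat -> F) N d :
  (forall q, 0 <= w q) -> partial_esym w N d <= (\sum_(0 <= q < N) w q) ^+ d / d`!%:R.
Proof.
move=> w0; elim: N d => [|N IH] d.
  by rewrite big_geq //; case: d => [|d] /=; rewrite ?expr0 ?divr1 // expr0n /= mul0r.
case: d => [|d]; first by rewrite /= expr0 divr1.
rewrite big_nat_recr //=; set s := \sum_(0 <= q < N) w q.
have s0 : 0 <= s by apply: sumr_ge0.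
apply: (le_trans (lerD (IH _) (ler_wpM2l (w0 N) (IH _)))).
rewrite -/s ler_pdivlMr ?ltr0n ?fact_gt0 // exprDn.
rewrite big_ord_recl big_ord_recl /= subn0 subn1 /= expr0 expr1 bin0 bin1 mulr1n mulr1.
have f0 : (d`!)%:R != 0 :> F by rewrite pnatr_eq0 -lt0n fact_gt0.
rewrite mulrDl divfK ?pnatr_eq0 -?lt0n ?fact_gt0 // addrA.
rewrite (_ : w N * (s ^+ d / d`!%:R) * d.+1`!%:R = (s ^+ d * w N) *+ d.+1).
  rewrite lerDl; apply: sumr_ge0 => i _.
  by rewrite mulrn_wge0 // mulr_ge0 ?exprn_ge0.
by rewrite factS natrM -[RHS]mulr_natr; field.
Qed.

(** Coefficients of [partial_esym] in the ring of power series, when the q-th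
    argument is the series with coefficients [a q]. *)
Fixpoint symcoef (L : pzSemiRingType) (a : nat -> nat -> L) (N d : nat) : nat -> L :=
  match N, d with
  | 0, _ => fun m => ((d == 0%N) && (m == 0%N))%:R
  | N'.+1, 0 => fun m => (m == 0%N)%:R
  | N'.+1, d'.+1 => fun m => symcoef a N' d m + cauchy_prod (a N') (symcoef a N' d') m
  end.

Lemma symcoef0r (L : pzSemiRingType) (a : nat -> nat -> L) N m :
  symcoef a N 0 m = (m == 0%N)%:R.
Proof. by case: N. Qed.

(** A product of d series without constant term starts in degree d. *)
Lemma symcoef_eq0 (L : pzSemiRingType) (a : nat -> nat -> L) N d m :
  (forall q, a q 0%N = 0) -> (m < d)%N -> symcoef a N d m = 0.
Proof.
move=> a0; elim: N d m => [|N IH] [|d] m //= md.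
rewrite IH // add0r /cauchy_prod big1 // => -[[|k] hk] _ /=; first by rewrite a0 mul0r.
rewrite IH ?mulr0 //; case: m md hk => [|m] // md hk.
by rewrite subSS (leq_ltn_trans (leq_subr _ _)).
Qed.

Lemma symcoef_ge0 (F : numDomainType) (a : nat -> nat -> F) N d m :
  (forall q k, 0 <= a q k) -> 0 <= symcoef a N d m.
Proof.
move=> a0; elim: N d m => [|N IH] [|d] m //=; try by rewrite ler0n.
by rewrite addr_ge0 //; apply: sumr_ge0 => k _; rewrite mulr_ge0.
Qed.

Lemma symcoef_le_succ (F : numDomainType) (a : nat -> nat -> F) N d m :
  (forall q k, 0 <= a q k) -> symcoef a N d m <= symcoef a N.+1 d m.
Proof.
move=> a0; case: d => [|d]; first by rewrite !symcoef0r.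
by rewrite /= lerDl; apply: sumr_ge0 => k _; rewrite mulr_ge0 ?symcoef_ge0.
Qed.

(** If the q-th series is dominated by w_q e^u, their d-th elementary symmetric
    polynomial is dominated by that of the weights times e^(d u). The induction is
    e^u e^(d u) = e^((d+1) u), that is, the binomial theorem. *)
Lemma symcoef_le (F : numFieldType) (a : nat -> nat -> F) (w : nat -> F) N d m :
  (forall q k, 0 <= a q k <= w q / k`!%:R) ->
  symcoef a N d m <= partial_esym w N d * (d%:R ^+ m / m`!%:R).
Proof.
move=> aw; have a0 q k : 0 <= a q k by case/andP: (aw q k).
have w0 q : 0 <= w q.
  by have /andP[h1 h2] := aw q 0%N; have := le_trans h1 h2; rewrite divr1.
elim: N d m => [|N IH] [|d] m /=; try by rewrite mul1r; case: m => [|m] //=;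
  rewrite ?expr0 ?divr1 // expr0n /= mul0r.
  by rewrite mul0r.
rewrite mulrDl; apply: lerD => //.
have nf k : (k`!)%:R != 0 :> F by rewrite pnatr_eq0 -lt0n fact_gt0.
rewrite -natr1 addrC exprDn -[w N * _]mulrC -mulrA !mulr_suml mulr_sumr.
rewrite mulr_sumr /cauchy_prod [leRHS](reindex_inj rev_ord_inj) /=.
apply: ler_sum => k _.
have km : (k <= m)%N by rewrite -ltnS.
rewrite subSS subKn // expr1n mul1r.
have /andP[_ awk] := aw N k.
apply: (le_trans (ler_pM _ _ awk (IH _ _))) => //; first exact: symcoef_ge0.
rewrite bin_sub // -(bin_fact km) !natrM -[_ *+ 'C(m, k)]mulr_natr.
have c0 : 'C(m, k)%:R != 0 :> F by rewrite pnatr_eq0 -lt0n bin_gt0.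
rewrite le_eqVlt; apply/orP; left; apply/eqP.
have := nf k; have := nf (m - k)%N.
move: (d%:R ^+ (m - k)) (partial_esym w N d) ('C(m, k)%:R) c0 (k`!%:R) ((m - k)`!%:R)
  => p e c c0 f1 f2 n1 n2.
by field; rewrite n1 n2 c0.
Qed.

End ElementarySymmetric.

(** * The infinite product as a power series in two variables *)

Section InfiniteProduct.
Variable R : realType.
Local Notation K := (Cplx R).

Lemma ger0_norm_ofReal (c : R) : 0 <= c -> `|ofReal c| = ofReal c.
Proof. by move=> c0; rewrite norm_ofReal ger0_norm. Qed.

Lemma exp_coeff_le_expR (x : R) n : 0 <= x -> x ^+ n / n`!%:R <= expR x.
Proof.
move=> x0.
case: n => [|n]; last by apply: le_trans (expR_ge1Dxn n x0); rewrite lerDr.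
by rewrite expr0 divr1; apply: le_trans (expR_ge1Dx x); rewrite lerDl.
Qed.

Lemma entire_exp (c B : R) : 0 <= c -> 0 <= B ->
  entire (fun m => ofReal (c * (B ^+ m / m`!%:R))).
Proof.
move=> c0 B0 r r0; have [s rs] := real_ofReal (ger0_real r0).
have s0 : 0 <= s by rewrite -ofReal_le -rs.
exists (ofReal (c * expR (B * s))) => n.
rewrite norm_ofReal rs -rmorphXn -rmorphM ofReal_le ger0_norm; last first.
  by rewrite mulr_ge0 ?divr_ge0 ?exprn_ge0.
rewrite -mulrA ler_wpM2l // mulrAC -exprMn; apply: exp_coeff_le_expR.
exact: mulr_ge0.
Qed.

(* From here on, [w] is a summable sequence of weights and the q-th factor of the
   product is 1 + y g_q(u), with g_q dominated by w_q e^u. *)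
Variables (a : nat -> nat -> R) (w : nat -> R) (W : R).
Hypothesis aw : forall q k, 0 <= a q k <= w q / k`!%:R.
Hypothesis wW : forall N, \sum_(0 <= q < N) w q <= W.

Let a0 q k : 0 <= a q k. Proof. by case/andP: (aw q k). Qed.
Let w0 q : 0 <= w q.
Proof. by have /andP[h1 h2] := aw q 0%N; have := le_trans h1 h2; rewrite divr1. Qed.
Let W0 : 0 <= W. Proof. by have := wW 0; rewrite big_geq. Qed.

Definition factor q (u : K) : K := psum (fun k => ofReal (a q k)) u.

Definition limcoef d m : R := limn (fun N => symcoef a N d m).

Definition limesym d (u : K) : K := psum (fun m => ofReal (limcoef d m)) u.

Lemma symcoef_le_exp N d m :
  symcoef a N d m <= W ^+ d / d`!%:R * (d%:R ^+ m / m`!%:R).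
Proof.
apply: (le_trans (symcoef_le N d m aw)).
apply: ler_wpM2r; first by rewrite divr_ge0 ?exprn_ge0.
apply: (le_trans (partial_esym_le_exp N d w0)).
apply: ler_wpM2r; first by rewrite invr_ge0.
by apply: lerXn2r; rewrite ?nnegrE //; apply: sumr_ge0.
Qed.

Lemma cvg_symcoef d m : (fun N => symcoef a N d m) @ \oo --> limcoef d m.
Proof.
apply: nondecreasing_is_cvgn.
  by apply/nondecreasing_seqP => N; apply: symcoef_le_succ.
exists (W ^+ d / d`!%:R * (d%:R ^+ m / m`!%:R)) => _ [N _ <-].
exact: symcoef_le_exp.
Qed.

Lemma entire_symcoef_bound d :
  entire (fun m => ofReal (W ^+ d / d`!%:R * (d%:R ^+ m / m`!%:R))).
Proof. by apply: entire_exp; rewrite ?divr_ge0 ?exprn_ge0. Qed.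

Lemma norm_symcoef_le N d m : `|ofReal (symcoef a N d m)| <=
  `|ofReal (W ^+ d / d`!%:R * (d%:R ^+ m / m`!%:R))|.
Proof.
have c0 := symcoef_ge0 N d m a0; have cb := symcoef_le_exp N d m.
by rewrite !norm_ofReal ofReal_le !ger0_norm // (le_trans c0).
Qed.

Lemma entire_symcoef N d : entire (fun m => ofReal (symcoef a N d m)).
Proof. exact: (entire_le (entire_symcoef_bound d) (norm_symcoef_le N d)). Qed.

Lemma entire_limcoef d : entire (fun m => ofReal (limcoef d m)).
Proof.
apply: (entire_le (entire_symcoef_bound d)) => m.
apply: (le_norm_cvg _ (cvg_ofReal _ (cvg_symcoef (d:=d) (m:=m)))).
  exact: normr_real.
by exists 0%N => // N _; apply: norm_symcoef_le.
Qed.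

Lemma entire_factor q : entire (fun k => ofReal (a q k)).
Proof.
apply: (@entire_le _ (fun k => ofReal (w q * (1 ^+ k / k`!%:R)))).
  exact: entire_exp.
move=> k; rewrite !norm_ofReal ofReal_le expr1n mul1r.
have /andP[h1 h2] := aw q k; rewrite !ger0_norm //; exact: le_trans h2.
Qed.

Lemma psum_delta (z : K) : psum (fun m => ofReal (m == 0%N)%:R) z = 1.
Proof.
have -> : (fun m => ofReal (m == 0%N)%:R) = (fun m => (1 : {poly K})`_m).
  by apply/funext => m; rewrite coef1 rmorph_nat.
by rewrite psum_poly hornerC.
Qed.

Lemma psum_symcoef N d u :
  psum (fun m => ofReal (symcoef a N d m)) u = partial_esym (factor^~ u) N d.
Proof.
elim: N d => [|N IH] [|d] /=; rewrite ?psum_delta //.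
  have -> : (fun m => ofReal 0) = (fun m => (0 : {poly K})`_m).
    by apply/funext => m; rewrite coef0 rmorph0.
  by rewrite psum_poly horner0.
rewrite -!IH; set b := fun m => ofReal (symcoef a N d m).
have [eb] := psum_cauchy_prod u (entire_factor N) (entire_symcoef N d).
rewrite -/(factor N u) => <-.
rewrite -psumD //; last exact: entire_symcoef.
congr psum; apply/funext => m; rewrite rmorphD; congr (_ + _).
by rewrite /cauchy_prod rmorph_sum; apply: eq_bigr => k _; rewrite rmorphM.
Qed.

Lemma cvg_partial_esym_factor d u :
  (fun N => partial_esym (factor^~ u) N d) @ \oo --> limesym d u.
Proof.
have -> : (fun N => partial_esym (factor^~ u) N d)
    = (fun N => psum (fun m => ofReal (symcoef a N d m)) u).
  by apply/funext => N; rewrite psum_symcoef.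
apply: (psum_dominated _ (entire_symcoef_bound d)).
  by near=> N => m; apply: norm_symcoef_le.
by move=> m; apply: cvg_ofReal; apply: cvg_symcoef.
Unshelve. all: by end_near.
Qed.

(** Majorant of the expansion in y, uniform in N: with s = |u| the constant is
    B = W e^(2 s), the 2 leaving room for a geometric bound in u. *)
Lemma norm_partial_esym_factor_le u : exists2 B : R, 0 <= B &
  forall N d, `|partial_esym (factor^~ u) N d| <= ofReal (2 * (B ^+ d / d`!%:R)).
Proof.
have [s s0 us] := norm_eq_ofReal u.
exists (W * expR (2 * s)) => [|N d]; first by rewrite mulr_ge0 ?expR_ge0.
rewrite -psum_symcoef exprMn mulrAC rmorphM rmorph_nat.
apply: norm_tsum_le => m.
rewrite normrM normrX us norm_ofReal -rmorphXn -rmorphM.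
rewrite -(rmorph_nat (@ofReal R : R -> K)) -rmorphXn -fmorphV -rmorphM ofReal_le.
rewrite ger0_norm ?symcoef_ge0 // ler_pdivlMr ?exprn_gt0 // -[leLHS]mulrA.
apply: (le_trans (ler_wpM2r _ (symcoef_le_exp N d m))).
  by rewrite mulr_ge0 ?exprn_ge0.
rewrite -[leLHS]mulrA ler_wpM2l ?divr_ge0 ?exprn_ge0 //.
rewrite -expRM_natl mulrAC [s ^+ m * _]mulrC -!exprMn.
by apply: exp_coeff_le_expR; rewrite !mulr_ge0.
Qed.

Lemma entire_limesym u : entire (limesym^~ u).
Proof.
have [B B0 hB] := norm_partial_esym_factor_le u.
apply: (entire_le (entire_exp (ler0n R 2) B0)) => d.
rewrite [leRHS]ger0_norm_ofReal ?mulr_ge0 ?divr_ge0 ?exprn_ge0 //.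
apply: (le_norm_cvg _ (@cvg_partial_esym_factor d u)).
- apply: ger0_real; rewrite -[0]/(ofReal 0) ofReal_le.
  by rewrite mulr_ge0 ?divr_ge0 ?exprn_ge0.
- by exists 0%N => // N _; apply: hB.
Qed.

(** The finite products are polynomials in y whose coefficients converge to
    [limesym], dominated by 2 B^d / d!. *)
Lemma cvg_prod_factor u y :
  (fun N => \prod_(0 <= q < N) (1 + y * factor q u)) @ \oo -->
  psum (limesym^~ u) y.
Proof.
have -> : (fun N => \prod_(0 <= q < N) (1 + y * factor q u))
    = (fun N => psum (partial_esym (factor^~ u) N) y).
  apply/funext => N.
  transitivity (psum (fun d => (\prod_(0 <= q < N) (1 + factor q u *: 'X))`_d) y).
    rewrite psum_poly horner_prod; apply: eq_bigr => q _.
    by rewrite hornerD hornerC hornerZ hornerX mulrC.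
  by congr psum; apply/funext => d; rewrite coef_prod_partial_esym.
have [B B0 hB] := norm_partial_esym_factor_le u.
apply: (psum_dominated _ (entire_exp (ler0n R 2) B0)).
  near=> N => d; rewrite [leRHS]ger0_norm_ofReal //.
  by rewrite mulr_ge0 ?divr_ge0 ?exprn_ge0.
by move=> d; apply: cvg_partial_esym_factor.
Unshelve. all: by end_near.
Qed.

End InfiniteProduct.

(** * The elementary symmetric function as a sum over increasing tuples *)

Section IncreasingTuples.

(** The increasing d-tuples with entries in 1, ..., N, those with last entry N
    coming last: the recursion of [partial_esym]. *)
Fixpoint inc_tuples N : forall d, seq (d.-tuple nat) :=
  match N with
  | 0 => fun d => match d with 0 => [:: [tuple]] | _.+1 => [::] end
  | N'.+1 => fun d => match d with
      | 0 => [:: [tuple]]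
      | d'.+1 => inc_tuples N' d'.+1 ++
                 [seq rcons_tuple t N'.+1 | t <- inc_tuples N' d']
      end
  end.

Lemma tuple_rconsP d (t : d.+1.-tuple nat) :
  exists (s : d.-tuple nat) x, t = rcons_tuple s x.
Proof.
case: t => u; case/lastP: u => // s x hs.
have hs' : size s == d by move: hs; rewrite size_rcons eqSS.
by exists (Tuple hs'), x; apply: val_inj.
Qed.

Lemma mem_inc_tuples N d (t : d.-tuple nat) :
  (t \in inc_tuples N d) = sorted ltn t && all (fun q => 1 <= q <= N)%N t.
Proof.
rewrite (sorted_pairwise ltn_trans).
elim: N d t => [|N IH] [|d] t /=; try by rewrite (tuple0 t).
  by case/tupleP: t => x t /=; case: x => [|x]; rewrite ?andbF.
rewrite mem_cat IH; have [s [x ->]] := tuple_rconsP t.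
rewrite /= !pairwise_rcons !all_rcons.
have -> : (rcons_tuple s x \in [seq rcons_tuple t0 N.+1 | t0 <- inc_tuples N d])
    = (x == N.+1) && (s \in inc_tuples N d).
  apply/mapP/andP => [[s' hs' /(congr1 val) /= /rcons_inj [e ->]]|[/eqP -> hs]].
    by split=> //; rewrite (val_inj e).
  by exists s.
rewrite IH; have [->|xN] := eqVneq x N.+1.
  rewrite ltnn !andbF ltnSn /=.
  case: (pairwise _ s); rewrite ?andbF ?andbT //=.
  apply/allP/andP => [h|[/allP h1 /allP h2] q qs]; last first.
    by have /andP[-> _] := h2 _ qs; have := h1 _ qs; rewrite ltnS.
  by split; apply/allP => q /h /andP[q1 qN]; rewrite ?ltnS // q1 leqW.
rewrite orbF [in RHS](leq_eqVlt x) (negbTE xN) /= ltnS.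
have [x1|] := boolP (1 <= x <= N)%N; last by rewrite !andbF.
have [h|] := boolP (all (ltn^~ x) s); last by [].
congr (_ && _); apply/eq_in_all => q qs.
have := allP h _ qs; have /andP[_ xN'] := x1 => /= qx.
by rewrite (ltnW (leq_trans qx xN')) (leqW (ltnW (leq_trans qx xN'))).
Qed.

Lemma uniq_inc_tuples N d : uniq (inc_tuples N d).
Proof.
elim: N d => [|N IH] [|d] //=.
rewrite cat_uniq IH map_inj_uniq ?IH ?andbT /=; last first.
  by move=> s t /(congr1 val) /= /rcons_inj [e]; apply: val_inj.
apply/hasPn => _ /mapP[t _ ->]; apply/negP => h.
have : rcons_tuple t N.+1 \in inc_tuples N d.+1 by [].
by rewrite mem_inc_tuples all_rcons ltnn !andbF.
Qed.

Lemma sum_inc_tuples (L : comPzSemiRingType) (a : nat -> L) N d :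
  \sum_(t <- inc_tuples N d) \prod_(q <- t) a q = partial_esym (fun q => a q.+1) N d.
Proof.
elim: N d => [|N IH] [|d] /=; rewrite ?big_seq1 ?big_nil //.
rewrite big_cat big_map IH -(IH d) mulr_sumr; congr (_ + _).
by apply: eq_bigr => t _; rewrite big_rcons /= mulrC.
Qed.

(** For nonnegative terms, the partial sums over the tuples bounded by N are
    cofinal among the finite partial sums. *)
Lemma elem_sym_limit (R : realType) (a : nat -> R) d l :
  (forall q, 0 <= a q) ->
  (fun N => partial_esym (fun q => a q.+1) N d) @ \oo --> l ->
  elem_sym a d = l%:E.
Proof.
move=> a0 el; pose e N := partial_esym (fun q => a q.+1) N d.
have p0 (t : d.-tuple nat) : (0 <= (\prod_(q <- t) a q)%:E)%E.
  by rewrite lee_fin; apply: prodr_ge0.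
have sumE N : (\sum_(t \in [set` inc_tuples N d]) (\prod_(q <- t) a q)%:E)%R = (e N)%:E.
  by rewrite -fsbig_seq ?uniq_inc_tuples // sumEFin sum_inc_tuples.
have nd : {homo e : m k / (m <= k)%N >-> m <= k}.
  apply/nondecreasing_seqP => N; rewrite /e.
  case: (d) => [|d']; first by rewrite !partial_esym0r.
  by rewrite /= lerDl mulr_ge0 ?partial_esym_ge0.
have le_l N : e N <= l.
  rewrite -(cvg_lim (@Rhausdorff R) el); apply: nondecreasing_cvgn_le => //.
  by apply/cvg_ex; exists l.
have upper : (elem_sym a d <= l%:E)%E.
  apply: ge_ereal_sup => _ [X [/finite_seqP[s ->] sub] <-].
  pose N := \max_(t <- s) \max_(q <- t) q.
  apply: (@le_trans _ _ (e N)%:E); last by rewrite lee_fin.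
  rewrite -sumE; apply: lee_fsum_nneg_subset => //; try exact: finite_seq.
  move=> t; rewrite !inE /= => ts.
  have /andP[st t1] := sub t ts.
  rewrite mem_inc_tuples st /=; apply/allP => q qt.
  rewrite (allP t1 q qt) /=.
  apply: leq_trans (leq_bigmax_seq t ts isT).
  exact: (@leq_bigmax_seq _ _ xpredT id q qt isT).
have lower N : ((e N)%:E <= elem_sym a d)%E.
  rewrite -sumE; apply: esum_ge; exists [set` inc_tuples N d] => //.
  split; first exact: finite_seq.
  move=> t /=; rewrite mem_inc_tuples => /andP[-> /=].
  by apply: sub_all => q /andP[].
apply/eqP; rewrite eq_le upper /=.
move: upper lower; case: (elem_sym a d) => [x| |] //= _ lower.
  rewrite lee_fin -(cvg_lim (@Rhausdorff R) el); apply: limr_le.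
    by apply/cvg_ex; exists l.
  by near=> N; rewrite -lee_fin; apply: lower.
by have := lower 0%N.
Unshelve. all: by end_near.
Qed.

End IncreasingTuples.

(** * The factors of the product *)

Section Factors.
Variable R : realType.
Local Notation K := (Cplx R).

(** Taylor coefficients of the factor of index q + 1. The base field is left
    abstract: the reals carry the order, the complex numbers the analysis. *)
Definition fcoef (F : fieldType) (q k : nat) : F :=
  if k == 0%N then 0 else (k.+1`!%:R * q.+1%:R ^+ k * q.+2%:R)^-1.

Definition fweight (F : fieldType) (q : nat) : F := (q.+1%:R * q.+2%:R)^-1.

Lemma fcoef_bound (F : numFieldType) q k :
  0 <= fcoef F q k <= fweight F q / k`!%:R.
Proof.
rewrite /fcoef /fweight; case: eqP => [->|/eqP k0].
  by rewrite lexx divr1 invr_ge0 mulr_ge0.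
rewrite invr_ge0 !mulr_ge0 ?exprn_ge0 //= -invfM.
rewrite lef_pV2 ?posrE ?mulr_gt0 ?exprn_gt0 ?ltr0n ?fact_gt0 //.
rewrite mulrC mulrA ler_wpM2r // ?ler0n // -natrX -!natrM ler_nat.
apply: leq_mul; first by rewrite factS leq_pmull.
by case: k k0 => // k _; rewrite expnS leq_pmulr // expn_gt0.
Qed.

(** The sum telescopes: w_q = 1/(q+1) - 1/(q+2). *)
Lemma sum_fweight_le (F : numFieldType) N : \sum_(0 <= q < N) fweight F q <= 1.
Proof.
have -> : \sum_(0 <= q < N) fweight F q = 1 - N.+1%:R^-1.
  elim: N => [|N IH]; first by rewrite big_geq // invr1 subrr.
  rewrite big_nat_recr //= IH /fweight.
  have n1 : N.+1%:R != 0 :> F by rewrite pnatr_eq0.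
  have n2 : N.+2%:R != 0 :> F by rewrite pnatr_eq0.
  have e : N.+2%:R = N.+1%:R + 1 :> F by rewrite -[in LHS]addn1 natrD.
  rewrite e in n2 *; move: (N.+1%:R) n1 n2 => x n1 n2.
  by field; rewrite n1 n2.
by rewrite gerBl invr_ge0.
Qed.

(** Division by u shifts the exponential series by one, whence the ranks N + 1
    and N + 2; removing its terms 1 and u/(q+1) leaves no constant term. *)
Lemma partial_sum_factor (F : numFieldType) (u : F) q N : u != 0 ->
  \sum_(0 <= n < N.+1) fcoef F q n * u ^+ n =
  (q.+1%:R * (\sum_(0 <= n < N.+2) (u / q.+1%:R) ^+ n / n`!%:R - 1) - u)
    / (u * (q.+1%:R + 1)).
Proof.
move=> u0; have q0 : q.+1%:R != 0 :> F by rewrite pnatr_eq0.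
have q1 : q.+1%:R + 1 != 0 :> F by rewrite natr1 pnatr_eq0.
elim: N => [|N IH].
  rewrite big_nat1 /fcoef /= mul0r big_nat_recr //= big_nat1.
  rewrite expr0 expr1 fact0 (_ : 1`! = 1%N) //.
  by move: (q.+1%:R) q0 q1 => Q q0 q1; field; rewrite q1 q0 u0.
rewrite big_nat_recr //= IH [in RHS]big_nat_recr //=.
rewrite /fcoef /= -[q.+2%:R]natr1 expr_div_n ![u ^+ N.+2]exprS [q.+1%:R ^+ N.+2]exprS.
have p0 : q.+1%:R ^+ N.+1 != 0 :> F by rewrite expf_neq0.
have f0 : N.+2`!%:R != 0 :> F by rewrite pnatr_eq0 -lt0n fact_gt0.
move: (\sum_(0 <= n < N.+2) _) (q.+1%:R ^+ N.+1) p0 (u ^+ N.+1) (N.+2`!%:R) f0 q0 q1.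
move: (q.+1%:R) => Q s p p0 v f f0 q0 q1.
by field; rewrite p0 f0 q0 q1 u0.
Qed.

Lemma ofReal_fcoef q k : ofReal (fcoef R q k) = fcoef K q k.
Proof.
rewrite /fcoef; case: ifP => _; first by rewrite rmorph0.
by rewrite fmorphV !rmorphM rmorphXn !rmorph_nat.
Qed.

Lemma expC_cvg (z : K) : series (fun n => z ^+ n / n`!%:R) @ \oo --> expC z.
Proof.
rewrite /expC.
have -> : (fun n => z ^+ n / n`!%:R) =
    (fun n => ofReal (1 * (1 ^+ n / n`!%:R)) * z ^+ n).
  by apply/funext => n; rewrite mul1r expr1n mul1r fmorphV rmorph_nat mulrC.
exact: (@cvg_psum R _ z (@entire_exp R 1 1 ler01 ler01)).
Qed.

(** At u = 0 both sides vanish: the value filled in at the singularity is the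
    constant term of the series. *)
Lemma factorH_psum q (u : K) : factorH q.+1 u = factor (fcoef R) q u.
Proof.
rewrite /factorH; have [->|u0] := eqVneq u 0.
  by rewrite /factor psum_at0 /fcoef /= rmorph0.
apply/esym/tsum_cvg_eq; rewrite -cvg_shiftS.
have -> : (fun N => series (fun n => ofReal (fcoef R q n) * u ^+ n) N.+1) =
  (fun N => (q.+1%:R * (series (fun n => (u / q.+1%:R) ^+ n / n`!%:R) N.+2 - 1) - u)
    * (u * (q.+1%:R + 1))^-1).
  apply/funext => N; rewrite /series /= -partial_sum_factor //.
  by apply: eq_bigr => n _; rewrite ofReal_fcoef.
have ce : (fun N => series (fun n => (u / q.+1%:R) ^+ n / n`!%:R) N.+2) @ \oo
    --> expC (u / q.+1%:R).
  rewrite (cvg_shiftS (fun N => series _ N.+1)) cvg_shiftS; exact: expC_cvg.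
have cc (c : K) : (fun _ : nat => c) @ \oo --> c by exact: cvg_cst.
exact: (cvgMr_tmp (cvgB (cvgMl_tmp (cvgB ce (cc 1))) (cc u))).
Qed.

Lemma expC_ofReal (x : R) : expC (ofReal x) = ofReal (expR x).
Proof.
apply: tsum_cvg_eq.
have -> : series (fun n => ofReal x ^+ n / n`!%:R) =
    (fun N => ofReal (series (exp_coeff x) N)).
  apply/funext => N; rewrite /series /= rmorph_sum; apply: eq_bigr => n _.
  by rewrite /exp_coeff /= rmorphM rmorphXn fmorphV rmorph_nat.
by apply: cvg_ofReal; apply: is_cvg_series_exp_coeff.
Qed.

Lemma factorH_bterm q : factorH q.+1 1 = ofReal (bterm R q.+1).
Proof.
rewrite /factorH oner_eq0.
have -> : 1 / q.+1%:R = ofReal (1 / q.+1%:R) :> K.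
  by rewrite rmorphM rmorph1 fmorphV rmorph_nat.
rewrite expC_ofReal [1 * (_ + 1)]mul1r /bterm.
have -> : expR (1 / q.+1%:R) / (1 + 1 / q.+1%:R) - 1 =
   (q.+1%:R * (expR (1 / q.+1%:R) - 1) - 1) / (q.+1%:R + 1) :> R.
  have q0 : q.+1%:R != 0 :> R by rewrite pnatr_eq0.
  have q1 : q.+1%:R + 1 != 0 :> R by rewrite natr1 pnatr_eq0.
  move: (expR _) => e; move: (q.+1%:R) q0 q1 => Q q0 q1.
  by field; rewrite q0 q1.
by rewrite rmorphM fmorphV rmorphB rmorphM rmorphB rmorphD !rmorph1 !rmorph_nat.
Qed.

Lemma bterm_gt0 q : (1 <= q)%N -> 0 < bterm R q.
Proof.
move=> q1; have x0 : 0 < 1 / q%:R :> R by rewrite divr_gt0 // ltr0n.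
rewrite /bterm; move: (1 / q%:R) x0 => x x0.
by rewrite subr_gt0 ltr_pdivlMr ?addr_gt0 // mul1r expR_gt1Dx // gt_eqF.
Qed.

Lemma prodH_psum (u : K) : prodH u = psum (fun d => limesym (fcoef R) d u).
Proof.
apply/funext => y; apply: cvg_lim; first exact: norm_hausdorff.
rewrite -cvg_shiftS.
have -> : (fun N => \prod_(1 <= q < N.+1) (1 + y * factorH q u)) =
    (fun N => \prod_(0 <= q < N) (1 + y * factor (fcoef R) q u)).
  apply/funext => N; rewrite big_add1 /=.
  by apply: eq_bigr => q _; rewrite factorH_psum.
exact: (cvg_prod_factor (@fcoef_bound R) (@sum_fweight_le R)).
Qed.

Lemma entire_limesym_fcoef (u : K) : entire (fun d => limesym (fcoef R) d u).
Proof. exact: (entire_limesym (@fcoef_bound R) (@sum_fweight_le R)). Qed.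

Lemma taylor1_prodH (u : K) d : taylor1 (prodH u) d = limesym (fcoef R) d u.
Proof.
rewrite /taylor1 prodH_psum derive1n_psum0; last exact: entire_limesym_fcoef.
by rewrite mulrC mulKf // pnatr_eq0 -lt0n fact_gt0.
Qed.

Lemma taylor2_prodH m d : taylor2 (@prodH R) m d = ofReal (limcoef (fcoef R) d m).
Proof.
have f0 n : n`!%:R != 0 :> K by rewrite pnatr_eq0 -lt0n fact_gt0.
have ec := entire_limcoef (@fcoef_bound R) (@sum_fweight_le R).
rewrite /taylor2.
have -> : (fun u => derive1n d (prodH u) 0) =
    psum (fun k => d`!%:R * ofReal (limcoef (fcoef R) d k)).
  apply/funext => u; rewrite prodH_psum derive1n_psum0; last first.
    exact: entire_limesym_fcoef.
  by rewrite (psumZ _ _ (ec d)).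
rewrite derive1n_psum0; last exact: entireZ.
by rewrite mulrA mulrC mulKf // mulf_neq0.
Qed.

Lemma cvg_ofReal_partial_esym_bterm d :
  (fun N => ofReal (partial_esym (fun q => bterm R q.+1) N d)) @ \oo -->
  limesym (fcoef R) d 1.
Proof.
have -> : (fun N => ofReal (partial_esym (fun q => bterm R q.+1) N d)) =
  (fun N => partial_esym ((factor (fcoef R))^~ 1) N d).
  apply/funext => N; rewrite partial_esym_morph; congr partial_esym; apply/funext => q.
  by rewrite -factorH_psum factorH_bterm.
exact: (cvg_partial_esym_factor (@fcoef_bound R) (@sum_fweight_le R)).
Qed.

Lemma cvg_partial_esym_bterm d :
  (fun N => partial_esym (fun q => bterm R q.+1) N d) @ \oo -->
  complex.Re (limesym (fcoef R) d 1).
Proof. by apply: cvg_Re; apply: cvg_ofReal_partial_esym_bterm. Qed.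

(** The partial masses are partial sums of E_d(1), the coefficients of index
    below d being zero. *)
Lemma cvg_partial_mass d : partial_mass R d @ \oo --> limesym (fcoef R) d 1.
Proof.
rewrite -cvg_shiftS.
have -> : (fun N => partial_mass R d N.+1)
    = series (fun m => ofReal (limcoef (fcoef R) d m) * 1 ^+ m).
  apply/funext => N; rewrite /partial_mass big_add1 /=.
  rewrite /series /= /taylorH.
  under eq_bigr => m _ do rewrite /= taylor2_prodH.
  under [RHS]eq_bigr do rewrite expr1n mulr1.
  have c0 m : (m < d)%N -> ofReal (limcoef (fcoef R) d m) = 0.
    move=> md; rewrite /limcoef; under eq_fun do rewrite symcoef_eq0 //.
    by rewrite lim_cst ?rmorph0.
  have [dN|Nd] := leqP d N.
    rewrite [RHS](big_cat_nat (leq0n d) dN) /= [X in X + _]big_nat.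
    by rewrite [X in X + _]big1 ?add0r // => m /c0.
  rewrite big_geq ?(ltnW Nd) // big_nat big1 // => m /= mN.
  by apply: c0; apply: ltn_trans Nd.
have ec := entire_limcoef (@fcoef_bound R) (@sum_fweight_le R).
exact: (@cvg_psum R _ 1 (ec d)).
Qed.

End Factors.

Theorem theorem6p2 (R : realType) :
  [/\ forall q : nat, (1 <= q)%N -> 0 < bterm R q,
      cvgn (fun N : nat => \sum_(1 <= q < N) bterm R q) &
      forall d : nat, (1 <= d)%N ->
        [/\ cvgn (partial_mass R d),
            column_mass R d = taylor1 (@prodH R 1) d,
            elem_sym (bterm R) d \is a fin_num &
            column_mass R d = ofReal (fine (elem_sym (bterm R) d))]].
Proof.
split.
- exact: bterm_gt0.
- apply/cvg_ex; exists (complex.Re (limesym (fcoef R) 1 1)).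
  rewrite -cvg_shiftS.
  have -> : (fun N => \sum_(1 <= q < N.+1) bterm R q) =
      (fun N => partial_esym (fun q => bterm R q.+1) N 1).
    apply/funext => N; rewrite big_add1 /=.
    elim: N => [|N IH]; first by rewrite big_geq.
    by rewrite big_nat_recr //= IH partial_esym0r mulr1.
  exact: cvg_partial_esym_bterm.
- move=> d _; have cm := @cvg_partial_mass R d.
  have cme : column_mass R d = limesym (fcoef R) d 1.
    by apply: cvg_lim => //; exact: norm_hausdorff.
  have bge0 q : 0 <= bterm R q.
    (* bterm 0 is 0, because 1 / 0 = 0 *)
    case: q => [|q]; last exact/ltW/bterm_gt0.
    by rewrite /bterm invr0 mulr0 expR0 addr0 divr1 subrr.
  have es := elem_sym_limit bge0 (@cvg_partial_esym_bterm R d).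
  split.
  + by apply/cvg_ex; exists (limesym (fcoef R) d 1).
  + by rewrite cme taylor1_prodH.
  + by rewrite es.
  + rewrite cme es /=; apply: (norm_cvg_unique (@cvg_ofReal_partial_esym_bterm R d)).
    by apply: cvg_ofReal; apply: cvg_partial_esym_bterm.
Qed.
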